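(* Let $(X,\gamma)$ be a generalized Minkowski space with $\dim(X)\geq 2$ (infinite dimension allowed). The following statements are equivalent. (i) The gauge $\gamma$ is a norm. (ii) Every straight line $K\subset X$ is coproximinal.
   Context: A generalized Minkowski space $(X,\gamma)$ is a real vector space $X$ (possibly infinite-dimensional) together with a gauge, i.e., a function $\gamma:X\to\mathbb{R}$ which takes only non-negative values, vanishes only at $0\in X$, and satisfies $\gamma(\lambda x)=\lambda\gamma(x)$ and $\gamma(x+y)\leq\gamma(x)+\gamma(y)$ for all $\lambda>0$ and $x,y\in X$. (So $\gamma(0)=0$, and $\gamma$ is a norm if and only if $\gamma(x)=\gamma(-x)$ for all $x\in X$.) For $K\subset X$ and $y\in X$, a point $x\in K$ is called a best coapproximation of $y$ in $K$ if $\gamma(x-z)\leq\gamma(y-z)$ for all $z\in K$; the set of all such $x$ is denoted by $Q_K(y)$. The set $K$ is called coproximinal if $Q_K(y)\neq\emptyset$ for all $y\in X$. A straight line is a set of the form $\{x+\lambda(y-x) : \lambda\in\mathbb{R}\}$ with $x,y\in X$, $x\neq y$. *)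

(* Defs.v *)
From HB Require Import structures.
From mathcomp Require Import all_boot all_order all_algebra.
From mathcomp Require Import boolp classical_sets reals.

Set Implicit Arguments.
Unset Strict Implicit.
Unset Printing Implicit Defensive.

Import Order.TTheory GRing.Theory Num.Theory.
Local Open Scope classical_set_scope.
Local Open Scope ring_scope.

Section GeneralizedMinkowski.
Context {R : realType} {X : lmodType R}.

Definition linearly_independent (n : nat) (v : 'I_n -> X) : Prop :=
  forall a : 'I_n -> R, \sum_(i < n) a i *: v i = 0 -> forall i, a i = 0.

(* gamma 0 = 0 is a consequence of is_gauge_homo, e.g. with l = 2. *)
Record is_gauge (gamma : X -> R) : Prop := IsGauge {
  is_gauge_ge0 : forall x, 0 <= gamma x;
  is_gauge_eq0 : forall x, gamma x = 0 -> x = 0;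
  is_gauge_homo : forall (l : R) x, 0 < l -> gamma (l *: x) = l * gamma x;
  is_gauge_triangle : forall x y, gamma (x + y) <= gamma x + gamma y
}.

Record is_norm (gamma : X -> R) : Prop := IsNorm {
  is_norm_ge0 : forall x, 0 <= gamma x;
  is_norm_eq0 : forall x, gamma x = 0 -> x = 0;
  is_norm_homo : forall (l : R) x, gamma (l *: x) = `|l| * gamma x;
  is_norm_triangle : forall x y, gamma (x + y) <= gamma x + gamma y
}.

(* The order of the arguments of gamma matters: gamma need not be even. *)
Definition best_coapproximations (gamma : X -> R) (K : set X) (y : X) : set X :=
  [set x | K x /\ forall z, K z -> gamma (x - z) <= gamma (y - z)].

Definition coproximinal (gamma : X -> R) (K : set X) : Prop :=
  forall y, best_coapproximations gamma K y !=set0.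

Definition straight_line (K : set X) : Prop :=
  exists x y : X, x <> y /\ K = [set x + l *: (y - x) | l in [set: R]].

End GeneralizedMinkowski.

(* Lower bound on the dimension that also makes sense when X is
   infinite-dimensional, hence not a vectType. *)
Definition dim_ge (R : realType) (X : lmodType R) (n : nat) : Prop :=
  exists v : 'I_n -> X, linearly_independent v.

(* Main.v *)
(** Translating by a point of a line K parallel to x, a best coapproximation of
y in K is a number t such that gamma(x + n y) >= (1 + t n) gamma(x) and
gamma(-x + n y) >= (1 - t n) gamma(-x) for all n >= 0.  Apply this at the points
x_l = d + l y of a line missing 0, with F(l) = gamma(x_l), G(l) = gamma(-x_l)
and t = t(l):
F(l + n) / F(l) >= 1 + t(l) n and G(l) / G(l + n) >= 1 - t(l + n) n.
Multiplying along a subdivision of [0, 1] into m steps, the factors combine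
pairwise into 1 - t(l)^2 / m^2, and t is bounded, so letting m tend to infinity
yields F(1) / G(1) >= F(0) / G(0).  Hence rho(x) = gamma(x) / gamma(-x) satisfies
rho(d) <= rho(w) <= rho(-d) = 1 / rho(d) when d and w are independent, so
rho <= 1 everywhere, and gamma is even.
Conversely, for a norm the coapproximation parameters are the common points of a
family of pairwise intersecting compact intervals. *)

Require Import Defs.
From mathcomp Require Import all_boot all_order all_algebra.
From mathcomp Require Import boolp classical_sets reals.
From mathcomp Require Import ring lra.

Set Implicit Arguments.
Unset Strict Implicit.
Unset Printing Implicit Defensive.

Import Order.TTheory GRing.Theory Num.Theory.
Local Open Scope classical_set_scope.
Local Open Scope ring_scope.

(** * Elementary real estimates *)

Lemma bernoulli_ineq (R : realDomainType) (x : R) (n : nat) :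
  0 <= x <= 1 -> 1 - n%:R * x <= (1 - x) ^+ n.
Proof.
move=> /andP[x0 x1]; elim: n => [|n IHn]; first by rewrite expr0 mul0r subr0.
rewrite exprS; apply: le_trans (ler_wpM2l _ IHn); last by rewrite subr_ge0.
have : 0 <= n%:R * x * x by rewrite !mulr_ge0.
by rewrite -natr1; nra.
Qed.

(** Stands in for a passage to the limit: after division by [n] the error is [c / n], which the
    Archimedean property makes negligible. *)
Lemma ler_of_arch (R : realType) (a b c : R) (N : nat) :
  (forall n, (N < n)%N -> n%:R * a <= n%:R * b + c) -> a <= b.
Proof.
move=> H; rewrite leNgt; apply/negP => ba.
have ab0 : 0 < a - b by rewrite subr_gt0.
have [n Hn] : exists n, c / (a - b) < n%:R.
  exists (Num.bound `|c / (a - b)|).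
  by apply: le_lt_trans (ler_norm _) _; apply: archi_boundP.
have := H (maxn n N.+1) (leq_maxr _ _).
have : c / (a - b) < (maxn n N.+1)%:R.
  by apply: lt_le_trans Hn _; rewrite ler_nat leq_maxl.
by rewrite ltr_pdivrMr //; lra.
Qed.

(** * Monotonicity of a quotient from one-sided linear growth bounds *)

Section Monotonicity.
Context {R : realType} (F G t : R -> R) (T : R).
Hypothesis F_gt0 : forall l, 0 < F l.
Hypothesis G_gt0 : forall l, 0 < G l.
Hypothesis t_le : forall l, `|t l| <= T.
Hypothesis F_step : forall l n, 0 <= n -> (1 + t l * n) * F l <= F (l + n).
Hypothesis G_step : forall l n, 0 <= n -> (1 - t l * n) * G l <= G (l - n).

Let T_ge0 : 0 <= T. Proof. exact: le_trans (normr_ge0 (t 0)) (t_le 0). Qed.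

Let tn_bound l n : 0 <= n -> - (T * n) <= t l * n <= T * n.
Proof.
by move=> n0; rewrite -ler_norml normrM (ger0_norm n0) ler_wpM2r.
Qed.

Let ratio_step l n : 0 <= n -> T * n < 1 ->
  (1 + t l * n) * (1 - t (l + n) * n) * (F l / G l) <= F (l + n) / G (l + n).
Proof.
move=> n0 Tn.
have /andP[a1 a2] := tn_bound l n0.
have /andP[b1 b2] := tn_bound (l + n) n0.
rewrite mulrA ler_pdivrMr // [leRHS]mulrAC ler_pdivlMr //.
have Fs := F_step l n0.
have := G_step (l + n) n0; rewrite addrK => Gs.
have -> : (1 + t l * n) * (1 - t (l + n) * n) * F l * G (l + n) =
  ((1 + t l * n) * F l) * ((1 - t (l + n) * n) * G (l + n)) by ring.
(* [T * n < 1] makes both linear factors nonnegative, so the two lower bounds may be multiplied. *)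
by apply: ler_pM => //; apply: mulr_ge0; rewrite ?ltW //; lra.
Qed.

(** The extra factor [1 + t l * n] at the current node [l] closes the induction: at the next node it
    meets [1 - t (l + n) * n] from [ratio_step], and the product is at least [1 - (T * n) ^+ 2]. *)
Let ratio_steps n k : 0 <= n -> T * n < 1 ->
  (1 - (T * n) ^+ 2) ^+ k * ((1 + t 0 * n) * (F 0 / G 0)) <=
  (1 + t (k%:R * n) * n) * (F (k%:R * n) / G (k%:R * n)).
Proof.
move=> n0 Tn; have Tn0 : 0 <= T * n by rewrite mulr_ge0.
elim: k => [|k IHk]; first by rewrite expr0 mul1r mul0r.
have c0 : 0 <= 1 - (T * n) ^+ 2 by nra.
rewrite exprS -mulrA; apply: le_trans (ler_wpM2l c0 IHk) _.
have -> : k.+1%:R * n = k%:R * n + n by rewrite -natr1 mulrDl mul1r.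
set l := k%:R * n.
have /andP[a1 a2] := tn_bound l n0.
have /andP[b1 b2] := tn_bound (l + n) n0.
have b0 : 0 <= 1 + t (l + n) * n by lra.
apply: le_trans (ler_wpM2l b0 (ratio_step l n0 Tn)).
have p0 : 0 <= (1 + t l * n) * (F l / G l).
  by rewrite mulr_ge0 ?divr_ge0 ?ltW //; lra.
have -> : (1 + t (l + n) * n) *
    ((1 + t l * n) * (1 - t (l + n) * n) * (F l / G l)) =
  (1 - (t (l + n) * n) ^+ 2) * ((1 + t l * n) * (F l / G l)) by ring.
apply: ler_wpM2r => //.
have : 0 <= (T * n - t (l + n) * n) * (T * n + t (l + n) * n).
  by apply: mulr_ge0; lra.
lra.
Qed.

Lemma ratio_le : F 0 / G 0 <= F 1 / G 1.
Proof.
have r00 : 0 < F 0 / G 0 by rewrite divr_gt0.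
have r10 : 0 < F 1 / G 1 by rewrite divr_gt0.
(* With step [n = 1 / m], the Bernoulli loss [T ^+ 2 * n] and the endpoint factors [1 - T * n] and
   [1 + T * n] cost, after multiplication by [m], the constant supplied below. Taking [m] beyond the
   bound of [T] ensures [T * n < 1]. *)
set r0 := F 0 / G 0 in r00 *; set r1 := F 1 / G 1 in r10 *.
apply: (@ler_of_arch _ _ _ (T * r1 + (T + T ^+ 2) * r0)
  (Num.bound T)) => m Tm.
have {}Tm : T < m%:R.
  apply: lt_trans (archi_boundP T_ge0) _.
  by rewrite ltr_nat.
have m0 : 0 < m%:R :> R by apply: le_lt_trans Tm.
have mm : m%:R * m%:R^-1 = 1 :> R by rewrite divff // gt_eqF.
set n : R := m%:R^-1 in mm *.
have n0 : 0 <= n by rewrite invr_ge0 ltW.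
have Tn : T * n < 1 by rewrite /n ltr_pdivrMr // mul1r.
have Tn0 : 0 <= T * n by rewrite mulr_ge0.
have := ratio_steps m n0 Tn; rewrite mm -/r0 -/r1.
have /andP[a1 _] := tn_bound 0 n0.
have /andP[_ b2] := tn_bound 1 n0.
have B : 1 - m%:R * (T * n) ^+ 2 <= (1 - (T * n) ^+ 2) ^+ m.
  by apply: bernoulli_ineq; nra.
have E : m%:R * (T * n) ^+ 2 = T ^+ 2 * n.
  by rewrite exprMn [n ^+ 2]expr2 mulrCA [m%:R * _]mulrA mm mul1r.
rewrite E in B => H.
have p0 : 0 <= (1 - (T * n) ^+ 2) ^+ m by apply: exprn_ge0; nra.
have H1 : (1 - (T * n) ^+ 2) ^+ m * ((1 - T * n) * r0) <= (1 + T * n) * r1.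
  apply: le_trans (le_trans _ H) _.
    by apply: ler_wpM2l => //; apply: ler_wpM2r; [exact: ltW | lra].
  by apply: ler_wpM2r; [exact: ltW | lra].
have q0 : 0 <= (1 - T * n) * r0 by rewrite mulr_ge0 ?ltW //; lra.
have H2 := le_trans (ler_wpM2r q0 B) H1.
have H3 : (1 - (T + T ^+ 2) * n) * r0 <= (1 + T * n) * r1.
  apply: le_trans H2; rewrite [leRHS]mulrA; apply: ler_wpM2r; first exact: ltW.
  have : 0 <= T ^+ 2 * n * (T * n) by rewrite !mulr_ge0 ?exprn_ge0.
  by lra.
have := ler_wpM2l (ltW m0) H3.
have -> : m%:R * ((1 - (T + T ^+ 2) * n) * r0) =
  m%:R * r0 - (T + T ^+ 2) * r0 * (m%:R * n) by ring.
have -> : m%:R * ((1 + T * n) * r1) =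
  m%:R * r1 + T * r1 * (m%:R * n) by ring.
rewrite mm; lra.
Qed.

End Monotonicity.

(** * Homogeneity and asymmetry of gauges *)

Section Gauge.
Context {R : realType} {X : lmodType R} (gamma : X -> R).
Hypothesis hgamma : is_gauge gamma.

Lemma gauge0 : gamma 0 = 0.
Proof.
have two_gt0 : 0 < 2 :> R by [].
by have := is_gauge_homo hgamma 0 two_gt0; rewrite scaler0; lra.
Qed.

Lemma gauge_homo (l : R) x : 0 <= l -> gamma (l *: x) = l * gamma x.
Proof.
rewrite le_eqVlt => /predU1P[<-|]; last exact: is_gauge_homo.
by rewrite scale0r mul0r gauge0.
Qed.

Lemma gauge_gt0 x : x <> 0 -> 0 < gamma x.
Proof.
move=> x0; rewrite lt_neqAle is_gauge_ge0 // andbT eq_sym.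
by apply/eqP => /(is_gauge_eq0 hgamma).
Qed.

Lemma gauge_homo_le (l : R) x : l * gamma x <= gamma (l *: x).
Proof.
have [l0|l0] := leP 0 l; first by rewrite gauge_homo.
apply: le_trans (is_gauge_ge0 hgamma _).
by apply: mulr_le0_ge0; [exact: ltW | exact: is_gauge_ge0].
Qed.

Lemma gauge_even_norm : (forall x, gamma (- x) = gamma x) -> is_norm gamma.
Proof.
move=> ev; split.
- exact: is_gauge_ge0 hgamma.
- exact: is_gauge_eq0 hgamma.
- move=> l x; have [l0|l0] := leP 0 l; first by rewrite gauge_homo ?ger0_norm.
  by rewrite -ev -scaleNr gauge_homo ?ltr0_norm // oppr_ge0 ltW.
- exact: is_gauge_triangle hgamma.
Qed.

(** A line through 0 has only two rays to compare; the sum of the two ratios serves both signs of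
    [s]. *)
Lemma gauge_opp_le x : exists2 C, 0 <= C &
  forall s, gamma (- (s *: x)) <= C * gamma (s *: x).
Proof.
have [->|/eqP x0] := eqVneq x 0.
  by exists 0 => // s; rewrite scaler0 oppr0 gauge0 mulr0.
have Nx0 : - x <> 0 by move/eqP; rewrite oppr_eq0 => /eqP.
have gx := gauge_gt0 x0; have gNx := gauge_gt0 Nx0.
have q1 : 0 <= gamma x / gamma (- x) by rewrite divr_ge0 ?ltW.
have q2 : 0 <= gamma (- x) / gamma x by rewrite divr_ge0 ?ltW.
exists (gamma x / gamma (- x) + gamma (- x) / gamma x); first exact: addr_ge0.
move=> s; have [s0|s0] := leP 0 s.
  rewrite -scalerN !gauge_homo // mulrDl [X in _ <= _ + X]mulrCA divfK ?gt_eqF //.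
  by rewrite lerDr (mulr_ge0 q1 (mulr_ge0 s0 (ltW gx))).
have Ns0 : 0 <= - s by rewrite oppr_ge0 ltW.
have -> : s *: x = (- s) *: (- x) by rewrite scaleNr scalerN opprK.
rewrite -scalerN opprK !gauge_homo // mulrDl [X in _ <= X + _]mulrCA.
rewrite divfK ?gt_eqF // lerDl.
exact: mulr_ge0 q2 (mulr_ge0 Ns0 (ltW gNx)).
Qed.

(** * Consequences of coproximinality of lines *)

Hypothesis lines_coproximinal :
  forall K : set X, straight_line K -> coproximinal gamma K.

Lemma coapprox_param x y : x <> 0 ->
  exists t, forall s, gamma ((t - s) *: x) <= gamma (y - s *: x).
Proof.
move=> x0.
have lK : straight_line [set 0 + l *: (x - 0) | l in [set: R]].
  by exists 0, x; split => // /esym.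
have [_ [[t _ <-] Ht]] := lines_coproximinal lK y.
exists t => s; have /Ht : [set 0 + l *: (x - 0) | l in [set: R]] (s *: x).
  by exists s => //; rewrite add0r subr0.
by rewrite add0r subr0 -scalerBl.
Qed.

(** For [n > 0], take [s = - n^-1] and [s = n^-1] in [coapprox_param] and scale by [n]. That one [t]
    serves both inequalities is what couples [gamma x] with [gamma (- x)]. *)
Lemma coapprox_subgradient x y : x <> 0 -> exists t, forall n, 0 <= n ->
  (1 + t * n) * gamma x <= gamma (x + n *: y) /\
  (1 - t * n) * gamma (- x) <= gamma (- x + n *: y).
Proof.
move=> x0; have [t Ht] := coapprox_param y x0; exists t => n.
rewrite le_eqVlt => /predU1P[<-|n0].
  by rewrite mulr0 addr0 subr0 !mul1r scale0r !addr0.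
have n1 : n * n^-1 = 1 by rewrite divff // gt_eqF.
split.
  have /(ler_wpM2l (ltW n0)) := Ht (- n^-1).
  rewrite -!(gauge_homo _ (ltW n0)) opprK scaleNr opprK scalerDr !scalerA.
  rewrite mulrDr n1 scale1r addrC (addrC _ x) (mulrC n); apply: le_trans.
  exact: gauge_homo_le.
have /(ler_wpM2l (ltW n0)) := Ht n^-1.
rewrite -!(gauge_homo _ (ltW n0)) scalerBr !scalerA n1 scale1r.
rewrite mulrBr n1 (addrC _ (- x)) (mulrC n); apply: le_trans.
have -> : (t * n - 1) *: x = (1 - t * n) *: (- x).
  by rewrite scalerN -scaleNr opprB.
exact: gauge_homo_le.
Qed.

(** Used to bound the parameters [t l]. The fixed nonzero vector [d - t *: y] is [d + l *: y] minus
    [(t + l) *: y], whose gauge is at most that of [d + l *: y]; [gauge_opp_le] absorbs the minus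
    sign. *)
Lemma gauge_line_lower_bound d y : (forall l : R, d + l *: y <> 0) ->
  exists2 c, 0 < c & forall l, c <= gamma (d + l *: y).
Proof.
move=> dy; have [y0|/eqP y0] := eqVneq y 0.
  exists (gamma d) => [|l]; last by rewrite y0 scaler0 addr0.
  by apply: gauge_gt0; have := dy 0; rewrite scale0r addr0.
have [C C0 HC] := gauge_opp_le y.
have [t Ht] := coapprox_param d y0.
have C1 : 0 < 1 + C by lra.
exists (gamma (d + (- t) *: y) / (1 + C)) => [|l].
  by rewrite divr_gt0 // gauge_gt0.
rewrite ler_pdivrMr // mulrC.
have -> : d + (- t) *: y = (d + l *: y) + - ((t + l) *: y).
  by rewrite scalerDl scaleNr opprD (addrC (- _)) addrA addrK.
apply: le_trans (is_gauge_triangle hgamma _ _) _; rewrite mulrDl mul1r lerD2l.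
apply: le_trans (HC _) _; apply: ler_wpM2l => //.
by have := Ht (- l); rewrite opprK scaleNr opprK.
Qed.

Lemma gauge_ratio_le_line d y : (forall l : R, d + l *: y <> 0) ->
  gamma d / gamma (- d) <= gamma (d + y) / gamma (- (d + y)).
Proof.
move=> dy.
have Ndy l : - d + l *: (- y) <> 0.
  by rewrite scalerN -opprD => /eqP; rewrite oppr_eq0 => /eqP; exact: dy.
have /choice[t Ht] : forall l, exists t, forall n, 0 <= n ->
    (1 + t * n) * gamma (d + l *: y) <= gamma (d + l *: y + n *: y) /\
    (1 - t * n) * gamma (- (d + l *: y)) <= gamma (- (d + l *: y) + n *: y).
  by move=> l; apply: coapprox_subgradient.
have [c1 c10 Hc1] := gauge_line_lower_bound dy.
have [c2 c20 Hc2] := gauge_line_lower_bound Ndy.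
have E l : - (d + l *: y) = - d + l *: (- y) by rewrite opprD scalerN.
have y_ge0 := is_gauge_ge0 hgamma y.
have t_le l : `|t l| <= gamma y / c1 + gamma y / c2.
  (* At [n = 1] the triangle inequality bounds [t l] and [- t l] from above; adding the two bounds
     covers both signs. *)
  have [] := Ht l 1 ler01; rewrite !mulr1 !scale1r => H1 H2.
  have {}H1 := le_trans H1 (is_gauge_triangle hgamma _ _).
  have {}H2 := le_trans H2 (is_gauge_triangle hgamma _ _).
  have {}H1 : t l * gamma (d + l *: y) <= gamma y by lra.
  have {}H2 : - t l * gamma (- (d + l *: y)) <= gamma y by lra.
  have q1 : 0 <= gamma y / c1 by rewrite divr_ge0 // ltW.
  have q2 : 0 <= gamma y / c2 by rewrite divr_ge0 // ltW.
  rewrite ler_norml; apply/andP; split.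
    rewrite lerNl; have [t0|t0] := leP (- t l) 0.
      by apply: le_trans t0 _; rewrite addr_ge0.
    suff : - t l <= gamma y / c2 by lra.
    rewrite ler_pdivlMr //; apply: le_trans H2.
    by apply: ler_wpM2l; rewrite ?(ltW t0) // E.
  have [t0|t0] := leP (t l) 0.
    by apply: le_trans t0 _; rewrite addr_ge0.
  suff : t l <= gamma y / c1 by lra.
  rewrite ler_pdivlMr //; apply: le_trans H1.
  by apply: ler_wpM2l; rewrite ?(ltW t0).
have := @ratio_le R (fun l => gamma (d + l *: y))
  (fun l => gamma (- (d + l *: y))) t _ _ _ t_le.
rewrite scale0r scale1r addr0; apply.
- by move=> l; exact: lt_le_trans (Hc1 l).
- by move=> l; rewrite E; exact: lt_le_trans (Hc2 l).
- by move=> l n n0; rewrite scalerDl addrA; case: (Ht l n n0).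
(* Adding [n *: y] to the opposite point moves the parameter backwards, from [l] to [l - n]. *)
- move=> l n n0; rewrite scalerBl addrA opprB [n *: y - _]addrC.
  by case: (Ht l n n0).
Qed.

Lemma gauge_ratio_le d w :
  (forall a b : R, a *: d + b *: w = 0 -> a = 0 /\ b = 0) ->
  gamma d / gamma (- d) <= gamma w / gamma (- w).
Proof.
move=> ind; have <- : d + (w - d) = w by rewrite addrC subrK.
apply: gauge_ratio_le_line => l.
(* A zero of [(1 - l) *: d + l *: w] would force both [l = 1] and [l = 0]. *)
rewrite scalerBr addrCA -[X in l *: w + (X - _)]scale1r -scalerBl addrC.
by move=> /ind[]; lra.
Qed.

Lemma gauge_opp_of_independent d w :
  (forall a b : R, a *: d + b *: w = 0 -> a = 0 /\ b = 0) ->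
  gamma (- d) = gamma d.
Proof.
move=> ind.
have d0 : d <> 0.
  move=> d0; have [] := ind 1 0; first by rewrite d0 scaler0 scale0r addr0.
  by move/eqP; rewrite oner_eq0.
(* The line from [e] to [- e] meets 0, so the comparison detours through [w]. *)
have le_opp e : e <> 0 ->
    (forall a b : R, a *: e + b *: w = 0 -> a = 0 /\ b = 0) ->
    gamma e <= gamma (- e).
  move=> e0 inde; have Ne0 : - e <> 0 by move/eqP; rewrite oppr_eq0 => /eqP.
  have H1 := gauge_ratio_le inde.
  have H2 : gamma w / gamma (- w) <= gamma (- e) / gamma (- - e).
    apply: gauge_ratio_le => a b.
    rewrite scalerN -scaleNr addrC => /inde[/eqP].
    by rewrite oppr_eq0 => /eqP -> ->.
  have := le_trans H1 H2; rewrite opprK.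
  have ge := gauge_gt0 e0; have gNe := gauge_gt0 Ne0.
  by rewrite ler_pdivrMr // mulrAC ler_pdivlMr //; nra.
apply/eqP; rewrite eq_le le_opp // andbT -{2}[d]opprK.
apply: le_opp => [/eqP|a b]; first by rewrite oppr_eq0 => /eqP.
rewrite scalerN -scaleNr => /ind[/eqP].
by rewrite oppr_eq0 => /eqP -> ->.
Qed.

End Gauge.

Lemma exists_independent (R : realType) (X : lmodType R) (d : X) :
  dim_ge X 2 -> d <> 0 ->
  exists w, forall a b : R, a *: d + b *: w = 0 -> a = 0 /\ b = 0.
Proof.
move=> [v indv] d0; apply: contrapT => /forallNP H.
have {}H w : exists l : R, w = l *: d.
  apply: contrapT => /forallNP Hw; apply: (H w) => a b E.
  have b0 : b = 0.
    apply: contrapT => /eqP b0; apply: (Hw (- (b^-1 * a))).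
    have := congr1 ( *:%R b^-1) E.
    rewrite scalerDr !scalerA mulVf // scale1r scaler0 scaleNr.
    by move/eqP; rewrite addrC addr_eq0 => /eqP.
  split=> //; move/eqP: E; rewrite b0 scale0r addr0 scaler_eq0.
  by case/orP => /eqP.
have [l0 E0] := H (v ord0); have [l1 E1] := H (v ord_max).
(* This relation forces [l0 = 0], so [v ord0 = 0], and the coefficients 1, 0 then contradict
   independence. *)
pose a (i : 'I_2) : R := if i == ord0 then l1 else - l0.
have /indv za : \sum_(i < 2) a i *: v i = 0.
  rewrite big_ord_recr big_ord1 /=.
  have -> : widen_ord (leqnSn 1) ord0 = ord0 by apply/val_inj.
  by rewrite E0 E1 /a /= !scalerA mulNr mulrC scaleNr subrr.
have l00 : l0 = 0 by apply/eqP; rewrite -oppr_eq0; apply/eqP; exact: (za ord_max).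
have /indv/(_ ord0) : \sum_(i < 2) (if i == ord0 then 1 else 0 : R) *: v i = 0.
  rewrite big_ord_recr big_ord1 /=.
  have -> : widen_ord (leqnSn 1) ord0 = ord0 by apply/val_inj.
  by rewrite E0 l00 !scale0r scaler0 addr0.
by move/eqP; rewrite oner_eq0.
Qed.

Lemma norm_coapprox_param (R : realType) (X : lmodType R) (gamma : X -> R)
    (d p : X) : is_norm gamma -> d <> 0 ->
  exists t : R, forall s, gamma ((t - s) *: d) <= gamma (p - s *: d).
Proof.
move=> [ge0 eq0 homo tri] d0.
have gd : 0 < gamma d.
  by rewrite lt_neqAle ge0 andbT eq_sym; apply/eqP => /eq0.
pose g s := gamma (p - s *: d) / gamma d.
have gK s : gamma (p - s *: d) = g s * gamma d by rewrite /g divfK // gt_eqF.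
(* The intervals [[s - g s, s + g s]] meet pairwise; evenness of the norm enters here. The supremum
   of their left endpoints then lies in all of them. *)
have sep s s' : s - g s <= s' + g s'.
  suff : `|s - s'| <= g s + g s' by rewrite ler_norml; lra.
  rewrite -(ler_pM2r gd) -homo mulrDl -!gK.
  have -> : (s - s') *: d = (p - s' *: d) + (-1) *: (p - s *: d).
    by rewrite scaleN1r opprB [RHS]addrC addrA subrK scalerBl.
  by apply: le_trans (tri _ _) _; rewrite homo normrN1 mul1r addrC.
pose S := [set s - g s | s in [set: R]].
have S0 : S !=set0 by exists (0 - g 0), 0.
exists (sup S) => s; rewrite homo gK ler_wpM2r ?(ltW gd) //.
have : s - g s <= sup S.
  apply: ub_le_sup; last by exists s.
  by exists (s + g s) => _ [s' _ <-]; exact: sep.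
have : sup S <= s + g s by apply: ge_sup => // _ [s' _ <-]; exact: sep.
by rewrite ler_norml; lra.
Qed.

Theorem theorem3p2 (R : realType) (X : lmodType R) (gamma : X -> R)
    (hgamma : is_gauge gamma) (hdim : dim_ge X 2) :
  is_norm gamma <->
  (forall K : set X, straight_line K -> coproximinal gamma K).
Proof.
split=> [hnorm _ [x [y [xy ->]]] p|hK].
  have yx : y - x <> 0 by move/eqP; rewrite subr_eq0 => /eqP /esym.
  (* Translation by [- x] moves the line to one through 0. *)
  have [t Ht] := norm_coapprox_param (p - x) hnorm yx.
  exists (x + t *: (y - x)); split=> [|_ [s _ <-]]; first by exists t.
  rewrite opprD addrACA subrr add0r -scalerBl addrA.
  exact: Ht.
apply: (gauge_even_norm hgamma) => d.
have [->|/eqP d0] := eqVneq d 0; first by rewrite oppr0.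
have [w ind] := exists_independent hdim d0.
exact: (gauge_opp_of_independent hgamma hK ind).
Qed.
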